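(* Let $\mathscr F_{\text{P-pt}}=\{F_c,F_f,F_s,F_i,F_p\}$ be the family of finitary operations on $\omega^\omega$ defined in the context, and let $\kappa$ be a regular cardinal. If there is a $\langle\mathfrak d,\mathscr F_{\text{P-pt}},\kappa\rangle$-pathway, then there is a P-point.
   Context: For $f,g\in\omega^\omega$, $f\le^* g$ means $f(n)\le g(n)$ for all but finitely many $n$. The cardinal characteristic $\mathfrak d$ is identified with the triple $\langle\omega^\omega,\omega^\omega,\le^*\rangle$. For a collection $\mathscr F$ of finitary operations on $\omega^\omega$ (functions $F:(\omega^\omega)^n\to\omega^\omega$, $n<\omega$) and a regular cardinal $\kappa$, a $\langle\mathfrak d,\mathscr F,\kappa\rangle$-pathway is an increasing continuous sequence $\langle B_\alpha : \alpha<\kappa\rangle$ of subsets of $\omega^\omega$ (continuous: $B_\alpha=\bigcup_{\xi<\alpha}B_\xi$ for limit $\alpha$) such that (1) $\bigcup_{\alpha<\kappa}B_\alpha=\omega^\omega$; (2) for every $\alpha<\kappa$ there is $x\in\omega^\omega$ with $x\not\le^* y$ for all $y\in B_\alpha$; (3) each $B_\alpha$ is closed under every $F\in\mathscr F$. Let $\mathfrak P(\omega)^{\downarrow\omega}$ be the set of all decreasing (with respect to $\supseteq$) sequences $\vec X=\langle X_n : n<\omega\rangle$ of subsets of $\omega$ with $\bigcap_{n<\omega}X_n=\varnothing$. Fix functions $\mathrm{Code}:\omega^\omega\to\mathfrak P(\omega)^{\downarrow\omega}$ and $\mathrm{Dcd}:\mathfrak P(\omega)^{\downarrow\omega}\to\omega^\omega$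 with $\mathrm{Code}\circ\mathrm{Dcd}=\mathrm{id}$. (For example, $\mathrm{Code}(f)=\langle\{k<\omega : n<f(k)\} : n<\omega\rangle$ and $\mathrm{Dcd}(\vec X)=\sum_{n<\omega}\chi_{X_n}$, where $\chi_X$ is the characteristic function of $X$; the specific choice is immaterial.) For $\vec X\in\mathfrak P(\omega)^{\downarrow\omega}$ and $f\in\omega^\omega$, let $e_n(\vec X)=X_n$ and $$\mathrm{Ps}(\vec X,f)=\bigcup_{n<\omega}X_n\cap f(n),$$ where $f(n)$ is identified with the set $\{0,\dots,f(n)-1\}$. Let $f_{\vec X}\in\omega^\omega$ be defined by $f_{\vec X}(0)=\min X_0+1$ and $f_{\vec X}(n+1)=\min\{k<\omega : k>f_{\vec X}(n)\wedge k\in X_{n+1}\}+1$ if all $X_n$ are infinite, and let $f_{\vec X}$ be constantly $0$ otherwise. For $g,h\in\omega^\omega$ define: - $F_c(h)=\mathrm{Dcd}(\langle(\omega\setminus e_0(\mathrm{Code}(h)))\setminus n : n<\omega\rangle)$; - $F_f(h)=f_{\mathrm{Code}(h)}$; - $F_s(h)=\mathrm{Dcd}(\langle e_0(\mathrm{Code}(h))\setminus n : n<\omega\rangle)$; - $F_p(g,h)=\mathrm{Dcd}(\langle\mathrm{Ps}(\mathrm{Code}(g),h)\setminus n : n<\omega\rangle)$; - $F_i(g,h)=\mathrm{Dcd}(\langle e_n(\mathrm{Code}(g))\cap e_n(\mathrm{Code}(h)) : n<\omega\rangle)$. A P-point is a nonprincipal ultrafilter $u$ on $\omega$ such that every countable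 subfamily of $u$ has a pseudointersection in $u$ (a set $X\in u$ such that $X\setminus Y$ is finite for each $Y$ in the subfamily). *)

(* Defs.v *)
From mathcomp Require Import all_boot all_order.
From mathcomp Require Import all_classical.
From mathcomp Require wochoice.

Set Implicit Arguments.
Unset Strict Implicit.
Unset Printing Implicit Defensive.

Local Open Scope classical_set_scope.
Local Open Scope card_scope.
Local Open Scope nat_scope.

Definition baire : Type := nat -> nat.

Definition le_star (f g : baire) : Prop := finite_set [set n | ~ (f n <= g n)].

(* A regular cardinal is given as a type ordered like it, so that the elements
   of K stand for the ordinals below the cardinal: K is a well-order, no proper
   initial segment of which is equinumerous with K (so it is an initial
   ordinal), infinite, and with every cofinal subset of full cardinality. *)

Definition cofinal {d} {K : orderType d} (A : set K) : Prop :=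
  forall a, exists2 b, A b & (a <= b)%O.

Definition regular_cardinal {d} (K : orderType d) : Prop :=
  [/\ wochoice.well_order (fun a b : K => (a <= b)%O),
      forall a : K, ~ ([set b | (b < a)%O] #= [set: K]),
      infinite_set [set: K] &
      forall A : set K, cofinal A -> A #= [set: K]].

Definition limit_point {d} {K : orderType d} (a : K) : Prop :=
  (exists b, (b < a)%O) /\
  (forall b, (b < a)%O -> exists2 c, (b < c)%O & (c < a)%O).

Record finop := Finop { arity : nat; op : ('I_arity -> baire) -> baire }.

Definition unary (F : baire -> baire) : finop :=
  @Finop 1 (fun x => F (x ord0)).

Definition binary (F : baire -> baire -> baire) : finop :=
  @Finop 2 (fun x => F (x ord0) (x ord_max)).

Definition closed_under (B : set baire) (F : finop) : Prop :=
  forall x : 'I_(arity F) -> baire, (forall i, B (x i)) -> B (op x).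

Record d_pathway (Fs : set finop) {d} {K : orderType d} (B : K -> set baire) :
    Prop := DPathway {
  pathway_increasing : forall a b : K, (a <= b)%O -> B a `<=` B b;
  pathway_continuous : forall a : K, limit_point a ->
    B a = \bigcup_(b in [set b | (b < a)%O]) B b;
  pathway_cover : \bigcup_(a in [set: K]) B a = [set: baire];
  pathway_unbounded : forall a : K,
    exists x, forall y, B a y -> ~ le_star x y;
  pathway_closed : forall (a : K) (F : finop), Fs F -> closed_under (B a) F }.

Record dseq := Dseq {
  dterm :> nat -> set nat;
  dterm_decreasing : forall m n, m <= n -> dterm n `<=` dterm m;
  dterm_cap : \bigcap_(n in [set: nat]) dterm n = set0 }.

Lemma tails_decreasing (A : set nat) m n :
  m <= n -> A `\` `I_n `<=` A `\` `I_m.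
Proof. by move=> mn x [Ax nx]; split=> //= xm; apply: nx; apply: leq_trans mn. Qed.

Lemma tails_cap (A : set nat) : \bigcap_(n in [set: nat]) (A `\` `I_n) = set0.
Proof. by rewrite -subset0 => x /(_ x.+1 I) [_]; apply=> /=. Qed.

Definition tails (A : set nat) : dseq :=
  Dseq (@tails_decreasing A) (tails_cap A).

Lemma dcap_decreasing (X Y : dseq) m n :
  m <= n -> X n `&` Y n `<=` X m `&` Y m.
Proof. by move=> mn; apply: setISS; apply: dterm_decreasing. Qed.

Lemma dcap_cap (X Y : dseq) : \bigcap_(n in [set: nat]) (X n `&` Y n) = set0.
Proof.
rewrite -subset0 -(dterm_cap X) => x XYx n _; by have [] := XYx n I.
Qed.

Definition dcap (X Y : dseq) : dseq :=
  Dseq (@dcap_decreasing X Y) (dcap_cap X Y).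

Definition Ps (X : nat -> set nat) (f : baire) : set nat :=
  \bigcup_(n in [set: nat]) (X n `&` `I_(f n)).

(* 0 on the empty set. *)
Definition least (A : set nat) : nat :=
  xget 0 [set n | A n /\ forall k, A k -> n <= k].

Fixpoint f_rec (X : nat -> set nat) (n : nat) : nat :=
  match n with
  | 0 => (least (X 0)).+1
  | m.+1 => (least [set k | f_rec X m < k /\ X m.+1 k]).+1
  end.

Definition f_of (X : nat -> set nat) : baire :=
  if `[< forall n, infinite_set (X n) >] then f_rec X else fun=> 0.

Section PptOperations.
Variables (Code : baire -> dseq) (Dcd : dseq -> baire).

Definition F_c (h : baire) : baire := Dcd (tails (~` Code h 0)).

Definition F_f (h : baire) : baire := f_of (Code h).

Definition F_s (h : baire) : baire := Dcd (tails (Code h 0)).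

Definition F_p (g h : baire) : baire := Dcd (tails (Ps (Code g) h)).

Definition F_i (g h : baire) : baire := Dcd (dcap (Code g) (Code h)).

Definition F_Ppt : set finop :=
  [set unary F_c; unary F_f; unary F_s; binary F_i; binary F_p].

End PptOperations.

Definition P_point (u : set_system nat) : Prop :=
  [/\ UltraFilter u,
      forall n, u <> principal_filter n &
      forall C : set (set nat), countable C -> C `<=` u ->
        exists2 X, u X & forall Y, C Y -> finite_set (X `\` Y)].

(* Main.v *)
Require Import Defs.
From mathcomp Require Import all_boot all_order.
From mathcomp Require Import all_classical.

Set Implicit Arguments.
Unset Strict Implicit.
Unset Printing Implicit Defensive.

Import Order.TTheory.

(** The P-point is an ultrafilter [U] read off along the pathway.  Write
    [coded a] for the sets, and [coded_seq a] for the decreasing sequences of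
    sets, that have a code in [B a]; the operations F_c, F_s and F_i make
    [coded a] a Boolean algebra and tie it to the sequences.

    The engine is one step (lemma [stage_extends]).  Let [U] be a free
    ultrafilter and let [x] be not dominated by any member of [B a].  Consider
    the pseudointersections [Ps X x], for [X] a sequence coded at [a] with all
    terms in [U].  Finitely many of them, say for X_1, ..., X_k, all contain
    [Ps Y x] where [Y] is the termwise intersection of the X_i, again coded at
    [a] (F_i).  The function [f_of Y] lies in [B a] (F_f), so [x] exceeds it
    infinitely often, and each time this happens a new element of [Y n] gets
    below [x n]: hence [Ps Y x] is infinite.  So there is a free ultrafilter
    [V] containing all these [Ps X x].  Applied to the sequences
    [tails A], this gives that [V] agrees with [U] on [coded a]; and the sets
    [Ps X x] are themselves coded at any [b] with [B b] containing [x] (F_p).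

    Iterating the step is done with Zorn's lemma on pairs of a level and a
    free ultrafilter, ordered by: same decisions on the sets coded at the
    lower level, and a pseudointersection, coded at the upper level, for every
    sequence coded at the lower one.  By the step there is no maximal pair, so
    some chain has no upper bound.  A chain has a limit ultrafilter
    ([chain_limit]), which would give an upper bound at any level above the
    chain; so the levels of the chain are cofinal, and then the limit
    ultrafilter is a P-point ([cofinal_chain_P_point]).  That last point uses
    that countably many levels are always bounded, which holds because
    countably many functions are dominated by one
    ([pathway_countable_bounded]). *)

Local Open Scope classical_set_scope.
Local Open Scope nat_scope.

(** * Sets and functions on the natural numbers *)

Lemma infinite_setP (A : set nat) :
  infinite_set A <-> forall m, exists2 n, A n & m <= n.
Proof.
split=> [Ainf m|Aunb /finite_seqP[s As]].
  have /infinite_setN0[n [An nm]] := infinite_setD Ainf (finite_II m).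
  by exists n => //; rewrite leqNgt; apply/negP.
have [n] := Aunb (\max_(i <- s) i).+1.
by rewrite As /= => sn; rewrite ltnNge leq_bigmax_seq.
Qed.

Lemma countable_le_star (x : nat -> baire) :
  exists y, forall n, le_star (x n) y.
Proof.
exists (fun k => \max_(n < k.+1) x n k) => n.
apply: (@sub_finite_set _ _ `I_n) => // k /= kn; rewrite ltnNge.
apply/negP => nk; apply: kn.
by rewrite -ltnS in nk; apply: (leq_bigmax (Ordinal nk)).
Qed.

(** * Free ultrafilters *)

Definition free_ultrafilter (U : set_system nat) : Prop :=
  UltraFilter U /\ forall A, U A -> infinite_set A.

Lemma free_ultrafilter_cofinite (U : set_system nat) m :
  free_ultrafilter U -> U (~` `I_m).
Proof.
move=> [UU Uinf]; have [/Uinf inf|//] := in_ultra_setVsetC `I_m UU.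
by case: inf.
Qed.

(** The ultrafilter is taken above the filter generated by the sets [A] minus
    an initial segment, for [A] in [D]; removing the initial segments is what
    makes it free. *)
Lemma free_ultrafilter_extends (D : set_system nat) :
  D !=set0 -> (forall A, D A -> infinite_set A) ->
  (forall A B, D A -> D B -> exists2 C, D C & C `<=` A `&` B) ->
  exists2 U, free_ultrafilter U & D `<=` U.
Proof.
move=> [A0 DA0] Dinf Ddir.
pose E := [set p : set nat * nat | D p.1].
pose F := filter_from E (fun p => p.1 `\` `I_p.2).
have FP : ProperFilter F.
  apply: filter_from_proper; last first.
    move=> [A m] /= DA.
    by apply/infinite_setN0/infinite_setD => //; exact: Dinf.
  apply: filter_from_filter; first by exists (A0, 0).
  move=> [A m] [B n] /= DA DB; have [C DC CAB] := Ddir _ _ DA DB.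
  exists (C, maxn m n) => //= k [/CAB[Ak Bk] /negP].
  by rewrite -leqNgt geq_max => /andP[mk nk]; split; split=> //=;
    apply/negP; rewrite -leqNgt.
have [U [UU FU]] := ultraFilterLemma FP; exists U; last first.
  by move=> A DA; apply: FU; exists (A, 0) => // k [].
split=> // A UA; apply/infinite_setP => m.
have UT : U (~` `I_m) by apply: FU; exists (A0, m) => // k [].
have [n [An /negP nm]] := filter_ex (filterI UA UT).
by exists n => //; rewrite leqNgt.
Qed.

(** * Infinite pseudointersections *)

Lemma f_rec_mem (X : nat -> set nat) n : (forall m, infinite_set (X m)) ->
  n < f_rec X n /\ X n (f_rec X n).-1.
Proof.
move=> Xinf.
have leastP (A : set nat) : A !=set0 -> A (least A).
  move=> A0; rewrite /least.
  pose P := [set n | A n /\ forall k, A k -> n <= k].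
  suff : P (xget 0 P) by case.
  apply: xgetPex.
  have ex : exists n, `[< A n >] by case: A0 => k Ak; exists k; apply/asboolP.
  case: (ex_minnP ex) => m /asboolP Am mle; exists m; split=> // k Ak.
  by apply/mle/asboolP.
elim: n => [|n [IH _]] /=.
  by split=> //; apply: leastP; apply: infinite_setN0; exact: Xinf.
set A := [set k | _].
have [k Xk ltk] := (infinite_setP _).1 (Xinf n.+1) (f_rec X n).+1.
have [ltA XA] : A (least A) by apply: leastP; exists k.
by split=> //; rewrite ltnS (leq_trans IH) // ltnW.
Qed.

(** If [f n] exceeds [f_of X n], then the element [(f_of X n).-1] of [X n] is
    put in [Ps X f].  It is at least [n], so infinitely many such [n] produce
    arbitrarily large elements. *)
Lemma infinite_Ps (X : nat -> set nat) (f : baire) :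
  (forall n, infinite_set (X n)) -> ~ le_star f (f_of X) ->
  infinite_set (Ps X f).
Proof.
move=> Xinf; rewrite /f_of asboolT // => /infinite_setP nle.
apply/infinite_setP => m; have [n /negP] := nle m.
rewrite -ltnNge => ltf mn; have [ltn Xn] := f_rec_mem n Xinf.
have eqf := ltn_predK ltn.
exists (f_rec X n).-1; last by rewrite (leq_trans mn) // -ltnS eqf.
by exists n => //; split=> //=; rewrite eqf ltnW.
Qed.

Lemma Ps_dcap (X Y : dseq) f : Ps (dcap X Y) f `<=` Ps X f `&` Ps Y f.
Proof. by move=> k [n _ [[Xk Yk] kf]]; split; exists n. Qed.

Lemma Ps_sub (X : dseq) f : Ps X f `<=` X 0.
Proof. by move=> k [n _ [Xk _]]; apply: dterm_decreasing Xk. Qed.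

(** The members of [Ps X f] outside [X n] come from the indices [m < n], each of
    which contributes only numbers below [f m]. *)
Lemma finite_Ps_diff (X : dseq) f n : finite_set (Ps X f `\` X n).
Proof.
pose D := \bigcup_(m in `I_n) `I_(f m).
apply: (@sub_finite_set _ _ D); last exact: bigcup_finite.
move=> k [[m _ [Xk kf]] nXk]; exists m => //=.
by rewrite ltnNge; apply/negP => nm; apply: nXk; apply: dterm_decreasing Xk.
Qed.

(** * Coded sets along a pathway *)

Section Pathway.
Variables (Code : baire -> dseq) (Dcd : dseq -> baire).
Hypothesis CodeDcd : forall X : dseq, Code (Dcd X) = X.
Variables (d : Order.disp_t) (K : orderType d) (B : K -> set baire).
Hypothesis pathB : d_pathway (F_Ppt Code Dcd) B.

Definition coded_seq (a : K) : set dseq := Code @` B a.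

Definition coded (a : K) : set_system nat :=
  [set A | exists2 X, coded_seq a X & X 0 = A].

Lemma B_unary F a g : F_Ppt Code Dcd (unary F) -> B a g -> B a (F g).
Proof.
by move=> FF Bg; apply: (pathway_closed pathB (a := a) FF (x := fun=> g)).
Qed.

Lemma B_binary F a g h :
  F_Ppt Code Dcd (binary F) -> B a g -> B a h -> B a (F g h).
Proof.
move=> FF Bg Bh.
by apply: (pathway_closed pathB FF (x := fun i => if i == ord0 then g else h))
  => i; case: ifP.
Qed.

Lemma coded_of_tails a A : coded_seq a (tails A) -> coded a A.
Proof. by exists (tails A) => //=; rewrite II0 setD0. Qed.

Lemma coded_le a b : (a <= b)%O -> coded a `<=` coded b.
Proof.
move=> ab A [_ [g Bg <-] <-]; exists (Code g) => //.
by exists g => //; apply: pathway_increasing pathB _ _ ab _ Bg.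
Qed.

Lemma coded_seq_tails a A : coded a A -> coded_seq a (tails A).
Proof.
move=> [_ [g Bg <-] <-]; exists (F_s Code Dcd g); last exact: CodeDcd.
by apply: B_unary Bg; left; left; right.
Qed.

Lemma codedC a A : coded a A -> coded a (~` A).
Proof.
move=> [_ [g Bg <-] <-]; apply: coded_of_tails.
exists (F_c Code Dcd g); last exact: CodeDcd.
by apply: B_unary Bg; do 4!left.
Qed.

Lemma coded_seqI a X Y :
  coded_seq a X -> coded_seq a Y -> coded_seq a (dcap X Y).
Proof.
move=> [g Bg <-] [h Bh <-]; exists (F_i Code Dcd g h); last exact: CodeDcd.
by apply: B_binary Bg Bh; left; right.
Qed.

Lemma codedI a A A' : coded a A -> coded a A' -> coded a (A `&` A').
Proof.
move=> [X aX <-] [Y aY <-]; exists (dcap X Y) => //; exact: coded_seqI.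
Qed.

Lemma coded_Ps a X f : coded_seq a X -> B a f -> coded a (Ps X f).
Proof.
move=> [g Bg <-] Bf; apply: coded_of_tails.
exists (F_p Code Dcd g f); last exact: CodeDcd.
by apply: B_binary Bg Bf; right.
Qed.

Lemma coded_seq_f_of a X : coded_seq a X -> B a (f_of X).
Proof.
move=> [g Bg <-]; rewrite -[f_of _]/(F_f Code g).
by apply: B_unary Bg; do 3!left; right.
Qed.

Lemma pathway_ex (x : baire) : exists a, B a x.
Proof.
have : (\bigcup_(a in [set: K]) B a) x by rewrite (pathway_cover pathB).
by case=> a _; exists a.
Qed.

(** If the levels [c n] were unbounded, take [x n] not dominated by any member
    of [B (c n)] and [y] dominating all the [x n]; [y] appears at some level,
    hence in some [B (c n)], which contradicts the choice of [x n]. *)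
Lemma pathway_countable_bounded (c : nat -> K) :
  exists b, forall n, (c n <= b)%O.
Proof.
have /choice[x xP] n := pathway_unbounded pathB (c n).
have [y xy] := countable_le_star x; have [b By] := pathway_ex y.
exists b => n; rewrite leNgt; apply/negP => /ltW /(pathway_increasing pathB).
by move=> /(_ _ By) /xP; apply.
Qed.

(** * Stages and their extensions *)

(** An approximation to the P-point.  Later stages keep only what [ultra] says
    about [coded level], but a full ultrafilter also decides the terms of the
    sequences in [coded_seq level]: these terms, other than the first, need not
    be in [coded level].  [level_inhabited] makes [coded level] a nonempty
    Boolean algebra. *)
Record stage := Stage {
  level : K;
  ultra : set_system nat;
  level_inhabited : coded_seq level !=set0;
  ultra_free : free_ultrafilter ultra }.

(** Asking the pseudointersection to be coded at [b] makes later stages keep it,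
    which gives transitivity and lets it survive in limits of chains.  The
    strict inequality makes extension irreflexive. *)
Definition extends (a : K) (U : set_system nat) (b : K) (V : set_system nat) :=
  [/\ (a < b)%O, U `&` coded a `<=` V &
      forall X : dseq, coded_seq a X -> (forall n, U (X n)) ->
        exists2 Z, (V `&` coded b) Z & forall n, finite_set (Z `\` X n)].

Definition before (s t : stage) : Prop :=
  extends (level s) (ultra s) (level t) (ultra t).

Lemma before_trans r s t : before r s -> before s t -> before r t.
Proof.
move=> [rs Urs Zrs] [st Ust _]; split; first exact: lt_trans st.
  move=> A rA; apply: Ust.
  by split; [exact: Urs|apply: coded_le (ltW rs) _ rA.2].
move=> X rX UX; have [Z [VZ sZ] Zfin] := Zrs X rX UX.
by exists Z => //; split; [exact: Ust|apply: coded_le (ltW st) _ sZ].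
Qed.

(** The step of the construction.  The sets [Ps X x] form a directed family of
    infinite sets.  It already determines [V] on [coded a], because
    [Ps (tails A) x] is contained in [A]. *)
Lemma stage_extends (s : stage) : exists t, before s t.
Proof.
case: s => a U [X0 aX0] Ufree; have [UU Uinf] := Ufree.
have [x xunb] := pathway_unbounded pathB a; have [b Bx] := pathway_ex x.
(* Otherwise [x] would be in [B a] and dominate itself. *)
have ab : (a < b)%O.
  rewrite ltNge; apply/negP => /(pathway_increasing pathB)/(_ _ Bx)/xunb; apply.
  by apply: (@sub_finite_set _ _ set0) => // n /=; rewrite leqnn.
pose G := [set X | coded_seq a X /\ forall n, U (X n)].
have Gtails A : U A -> coded a A -> G (tails A).
  move=> UA aA; split=> [|n]; first exact: coded_seq_tails.
  exact: filterI UA (free_ultrafilter_cofinite n Ufree).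
have Gcap X Y : G X -> G Y -> G (dcap X Y).
  move=> [aX UX] [aY UY]; split=> [|n]; first exact: coded_seqI.
  exact: filterI.
have GT : G (tails setT).
  apply: Gtails; first exact: filterT.
  have aA : coded a (X0 0) by exists X0.
  have aN := codedC (codedI aA (codedC aA)).
  by move: aN; rewrite setICr setC0.
have [V Vfree GV] : exists2 V, free_ultrafilter V &
    (Ps^~ x \o dterm) @` G `<=` V.
  apply: free_ultrafilter_extends; first by eexists; exists (tails setT).
    move=> _ [X [aX UX] <-] /=; apply: infinite_Ps => [n|]; first exact/Uinf.
    exact/xunb/coded_seq_f_of.
  move=> _ _ [X GX <-] [Y GY <-]; exists (Ps (dcap X Y) x); last exact: Ps_dcap.
  by exists (dcap X Y) => //; exact: Gcap.
have seqab X : coded_seq a X -> coded_seq b X.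
  move=> [g Bg <-]; exists g => //.
  exact: pathway_increasing pathB _ _ (ltW ab) _ Bg.
have b0 : coded_seq b !=set0 by exists X0; exact: seqab.
exists (Stage b0 Vfree); split=> //=.
  move=> A [UA aA]; have VU := Vfree.1.
  apply: filterS (GV _ _); last by exists (tails A) => //; exact: Gtails.
  by move=> k /Ps_sub[].
move=> X aX UX; exists (Ps X x); last by move=> n; exact: finite_Ps_diff.
by split; [apply: GV; exists X|apply: coded_Ps => //; exact: seqab].
Qed.

(** Along a chain the restrictions of the ultrafilters to the coded sets
    increase, so their union is directed.  Any ultrafilter above it agrees with [ultra s]
    on [coded (level s)], as these coded sets are closed under complement. *)
Lemma chain_limit (C : set stage) : C !=set0 ->
  (forall s t, C s -> C t -> [\/ s = t, before s t | before t s]) ->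
  exists2 U, free_ultrafilter U &
    forall s, C s -> ultra s `&` coded (level s) `<=` U.
Proof.
move=> [s0 Cs0] Ctot.
pose D := \bigcup_(s in C) (ultra s `&` coded (level s)).
have [|A [s _ [sA _]]||U Ufree DU] := @free_ultrafilter_extends D.
- have [X0 aX0] := level_inhabited s0.
  have aA : coded (level s0) (X0 0) by exists X0.
  have [UU _] := ultra_free s0.
  have [UA|UA] := in_ultra_setVsetC (X0 0) UU.
    by exists (X0 0), s0.
  by exists (~` X0 0), s0 => //; split=> //; exact: codedC.
- by have [_ /(_ _ sA)] := ultra_free s.
- have DI s t A A' : C t -> before s t \/ s = t ->
      (ultra s `&` coded (level s)) A -> (ultra t `&` coded (level t)) A' ->
      D (A `&` A').
    move=> Ct st [sA cA] [tA' cA']; exists t => //.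
    have [tA ctA] : (ultra t `&` coded (level t)) A.
      case: st => [[st Ust _]|<-] //; split; first exact: Ust.
      exact: coded_le (ltW st) _ cA.
    have [UU _] := ultra_free t.
    by split; [exact: filterI|exact: codedI].
  move=> A A' [s Cs sA] [t Ct tA']; exists (A `&` A') => //.
  have [st|st|ts] := Ctot s t Cs Ct.
  + by apply: DI sA tA' => //; right.
  + by apply: DI sA tA' => //; left.
  + by rewrite setIC; apply: DI tA' sA => //; left.
- by exists U => // s Cs A sA; apply: DU; exists s.
Qed.

(** A countable subfamily [c] of [U] is replaced by a sequence [Y] that
    decreases to the empty set.  Its terms are coded at levels below a common one, so at
    some stage [s] of the chain the sequence and all its terms are coded.  There
    [ultra s] agrees with [U] on the terms, and the next stage contains the
    pseudointersection. *)
Lemma cofinal_chain_P_point (C : set stage) (U : set_system nat) :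
  free_ultrafilter U ->
  (forall s, C s -> ultra s `&` coded (level s) `<=` U) ->
  (forall s, C s -> exists2 t, C t & before s t) ->
  (forall a, exists2 s, C s & (a <= level s)%O) ->
  P_point U.
Proof.
move=> [UU Uinf] CU Cnext Ccof; split=> //.
  move=> n Un; have /Uinf : U [set n] by rewrite Un; apply/principal_filterP.
  by apply; exact: finite_set1.
move=> F /pfcard_geP[->|[c]] FU.
  by exists setT => //; exact: filterT.
have Uc n : U (c n) by apply: FU; exact: funS.
(* The condition [n <= k] makes the intersection of the [X n] empty. *)
pose X n := [set k | (forall i, i <= n -> c i k) /\ n <= k].
have Xdec m n : m <= n -> X n `<=` X m.
  move=> mn k [ck nk]; split; last exact: leq_trans nk.
  by move=> i im; apply: ck; exact: leq_trans mn.
have Xcap : \bigcap_(n in [set: nat]) X n = set0.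
  by rewrite -subset0 => k /(_ k.+1 I)[_]; rewrite ltnn.
pose Y := Dseq Xdec Xcap.
have UX n : U (X n).
  have Ucap : forall m, U [set k | forall i, i <= m -> c i k].
    elim=> [|m IH].
      by apply: filterS (Uc 0) => k ck i; rewrite leqn0 => /eqP->.
    apply: filterS (filterI IH (Uc m.+1)) => k [ck cmk] i.
    by rewrite leq_eqVlt => /orP[/eqP->//|]; exact: ck.
  have Uge := free_ultrafilter_cofinite n (conj UU Uinf).
  apply: filterS (filterI (Ucap n) Uge).
  by move=> k [ck /negP]; rewrite -leqNgt => nk; split.
have /choice[l Bl] n := pathway_ex (Dcd (tails (X n))).
have [a la] := pathway_countable_bounded l.
have [b BY] := pathway_ex (Dcd Y).
have [s Cs abs] := Ccof (Order.max a b).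
have [as_ bs] : (a <= level s)%O /\ (b <= level s)%O.
  by apply/andP; rewrite -ge_max.
have sX n : coded (level s) (X n).
  apply: coded_le (le_trans (la n) as_) _ _; apply: coded_of_tails.
  by exists (Dcd (tails (X n))).
have sUX n : ultra s (X n).
  have [sUU _] := ultra_free s.
  have [//|sC] := in_ultra_setVsetC (X n) sUU.
  have UC : U (~` X n) by apply: (CU s Cs); split=> //; exact: codedC.
  by have /Uinf[] : U set0 by rewrite -(setICr (X n)); exact: filterI.
have sY : coded_seq (level s) Y.
  exists (Dcd Y) => //; exact: pathway_increasing pathB _ _ bs _ BY.
have [t Ct [_ _ /(_ Y sY sUX)[Z Zt Zfin]]] := Cnext s Cs.
exists Z; first exact: CU _ Ct _ Zt.
move=> A FA; have [n _ <-] := 'surj_c FA.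
by apply: sub_finite_set (Zfin n) => k [Zk nck]; split=> // -[/(_ n (leqnn n))].
Qed.

Lemma initial_stage : inhabited stage.
Proof.
have [U Ufree _] : exists2 U, free_ultrafilter U & [set setT] `<=` U.
  apply: free_ultrafilter_extends; first by exists setT.
    by move=> _ ->; exact: infinite_nat.
  by move=> _ _ -> ->; exists setT => //; rewrite setIT.
have [a Ba] := pathway_ex (fun=> 0).
have a0 : coded_seq a !=set0 by exists (Code (fun=> 0)), (fun=> 0).
exact: inhabits (Stage a0 Ufree).
Qed.

(** If there is no P-point, the levels of a chain without maximum cannot be
    cofinal, so some level [c] lies above all of them; the limit ultrafilter at
    level [c] is then an upper bound.  Its pseudointersections come from stages
    inside the chain.  Zorn's lemma thus yields a maximal stage, which
    contradicts [stage_extends]. *)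
Lemma pathway_P_point : exists u : set_system nat, P_point u.
Proof.
apply: contrapT => noP.
pose R (s t : stage) := `[< s = t \/ before s t >].
have [s0] := initial_stage.
have [|r s t /asboolP[<-//|rs] /asboolP[<-|st]|C Ctot|s smax] :=
  @ZL_preorder _ s0 R.
- by move=> s; apply/asboolP; left.
- by apply/asboolP; right.
- by apply/asboolP; right; apply: before_trans st.
- have [[m Cm mtop]|nomax] :=
      pselect (exists2 m, C m & forall s, C s -> R s m).
    by exists m.
  have [C0|/set0P C0] := eqVneq C set0; first by exists s0 => s; rewrite C0.
  have Ctot' s t : C s -> C t -> [\/ s = t, before s t | before t s].
    move=> Cs Ct; have [/asboolP[->|?]|/asboolP[->|?]] := Ctot s t Cs Ct;
    by [constructor 1|constructor 2|constructor 3].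
  have Cnext s : C s -> exists2 t, C t & before s t.
    move=> Cs; apply: contrapT => nos; apply: nomax; exists s => // t Ct.
    apply/asboolP; have [->|ts|st] := Ctot' t s Ct Cs; [by left|by right|].
    by case: nos; exists t.
  have [U Ufree CU] := chain_limit C0 Ctot'.
  have [c Cc] : exists c, forall s, C s -> (level s <= c)%O.
    apply: contrapT => nobound; apply: noP; exists U.
    apply: (cofinal_chain_P_point Ufree CU Cnext) => a.
    apply: contrapT => noa; apply: nobound; exists a => s Cs.
    by rewrite leNgt; apply/negP => /ltW le; apply: noa; exists s.
  have [s1 Cs1] := C0.
  have c0 : coded_seq c !=set0.
    have [X [g Bg gX]] := level_inhabited s1; exists X, g => //.
    exact: pathway_increasing pathB _ _ (Cc _ Cs1) _ Bg.
  exists (Stage c0 Ufree) => s Cs; apply/asboolP; right.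
  have [t Ct [st _ Zst]] := Cnext s Cs.
  split=> /=; [exact: lt_le_trans (Cc _ Ct)|exact: CU|].
  move=> X sX UX; have [Z [tZ cZ] Zfin] := Zst X sX UX; exists Z => //.
  by split; [exact: CU _ Ct _ (conj tZ cZ)|exact: coded_le (Cc _ Ct) _ cZ].
have [t st] := stage_extends s.
have /asboolP[ts|[ts _ _]] : R t s by apply: smax; apply/asboolP; right.
  by case: st; rewrite ts ltxx.
by case: st => st _ _; have := lt_trans st ts; rewrite ltxx.
Qed.

End Pathway.

Theorem theorem4p2 (Code : baire -> dseq) (Dcd : dseq -> baire)
    (CodeDcd : forall X : dseq, Code (Dcd X) = X)
    (d : Order.disp_t) (K : orderType d) (regK : regular_cardinal K) :
  (exists B : K -> set baire, d_pathway (F_Ppt Code Dcd) B) ->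
  exists u : set_system nat, P_point u.
Proof. by move=> [B]; apply: pathway_P_point. Qed.
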